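(* Let $s\in\mathbb{Z}_n^{*}$ and let $B_n$ be the corresponding dihedral biquandle, and suppose that $s+1\in\mathbb{Z}_n^{*}$. Then $Aut(B_n)\cong C_{\mathrm{Aff}(\mathbb{Z}_n)}(s)$, the centralizer in $\mathrm{Aff}(\mathbb{Z}_n)$ of the map $i\mapsto si$.
   Context: Here $\mathbb{Z}_n=\mathbb{Z}/n\mathbb{Z}$ and $\mathbb{Z}_n^{*}$ is its group of units. For $s\in\mathbb{Z}_n^{*}$, the dihedral biquandle $B_n$ is the set $\mathbb{Z}_n$ with the two binary operations $i\,\underline{\ast}\,j=(s+1)j-i$ and $i\,\overline{\ast}\,j=si$. $Aut(B_n)$ is the group of bijections of $\mathbb{Z}_n$ preserving both operations. The affine group is $\mathrm{Aff}(\mathbb{Z}_n)=\{f_{a,b}\colon\mathbb{Z}_n\to\mathbb{Z}_n\mid f_{a,b}(i)=ai+b,\ a\in\mathbb{Z}_n^{*},\ b\in\mathbb{Z}_n\}$ under composition; $s$ is identified with the element $f_{s,0}$. *)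

(* Defs.v *)
From HB Require Import structures.
From mathcomp Require Import all_boot all_fingroup all_algebra.

Set Implicit Arguments.
Unset Strict Implicit.
Unset Printing Implicit Defensive.

Import GRing.Theory.
Local Open Scope ring_scope.

(* Z/(n+1)Z is 'I_n.+1 with the operations of zmodp.v. The notation 'Z_n is not
   used because 'Z_1 is Z/2Z. As 'I_1 has no ring structure in the library, the
   product is written Zp_mul, the unit element Zp1, and units are defined here. *)
Definition Zn_units (n : nat) : {set 'I_n.+1} :=
  [set a | [exists b, Zp_mul a b == Zp1]].

Definition dihedral_under (n : nat) (s i j : 'I_n.+1) : 'I_n.+1 :=
  Zp_mul (s + Zp1) j - i.

Definition dihedral_over (n : nat) (s i j : 'I_n.+1) : 'I_n.+1 :=
  Zp_mul s i.

Definition preserves_op (T : finType) (op : T -> T -> T) (p : {perm T}) : bool :=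
  [forall x, forall y, p (op x y) == op (p x) (p y)].

(* In {perm T}, (p * q) x = q (p x). *)
Definition Aut_ops (T : finType) (under over : T -> T -> T) : {set {perm T}} :=
  [set p | preserves_op under p && preserves_op over p].

Lemma preserves_op1 (T : finType) (op : T -> T -> T) : preserves_op op 1%g.
Proof. by apply/forallP=> x; apply/forallP=> y; rewrite !perm1. Qed.

Lemma preserves_opM (T : finType) (op : T -> T -> T) (p q : {perm T}) :
  preserves_op op p -> preserves_op op q -> preserves_op op (p * q)%g.
Proof.
move=> /forallP pP /forallP qP; apply/forallP=> x; apply/forallP=> y.
by rewrite !permM (eqP (forallP (pP x) y)) (eqP (forallP (qP (p x)) (p y))).
Qed.

Lemma Aut_ops_group_set (T : finType) (under over : T -> T -> T) :
  group_set (Aut_ops under over).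
Proof.
apply/group_setP; split=> [|p q]; rewrite !inE ?preserves_op1 //.
by move=> /andP[pu po] /andP[qu qo]; rewrite !preserves_opM.
Qed.

Canonical Aut_ops_group (T : finType) (under over : T -> T -> T) :=
  Group (Aut_ops_group_set under over).

Definition Aut_dihedral (n : nat) (s : 'I_n.+1) : {group {perm 'I_n.+1}} :=
  [group of Aut_ops (dihedral_under s) (dihedral_over s)].

Definition affine_map (n : nat) (a b i : 'I_n.+1) : 'I_n.+1 := Zp_mul a i + b.

Lemma affine_map_inj (n : nat) (a b : 'I_n.+1) :
  a \in Zn_units n -> injective (affine_map a b).
Proof.
rewrite inE => /existsP[c /eqP ac1] i j /addIr aij.
rewrite -[i]Zp_mul1z -[j]Zp_mul1z -ac1 (Zp_mulC a) -!Zp_mulA.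
exact: congr1 aij.
Qed.

Definition affine_perm (n : nat) (a b : 'I_n.+1) (ha : a \in Zn_units n) :
  {perm 'I_n.+1} := perm (affine_map_inj (b := b) ha).

Definition Aff_set (n : nat) : {set {perm 'I_n.+1}} :=
  [set p : {perm 'I_n.+1} | [exists a in Zn_units n, exists b,
     [forall i, p i == affine_map a b i]]].

Lemma AffP (n : nat) (p : {perm 'I_n.+1}) :
  reflect (exists a b (ha : a \in Zn_units n), p = affine_perm b ha)
          (p \in Aff_set n).
Proof.
rewrite inE; apply: (iffP exists_inP) => [[a ha /existsP[b /forallP pE]]|].
  by exists a, b, ha; apply/permP=> i; rewrite permE; apply/eqP.
move=> [a [b [ha ->]]]; exists a => //; apply/existsP; exists b.
by apply/forallP=> i; rewrite permE.
Qed.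

Lemma Aff_group_set (n : nat) : group_set (Aff_set n).
Proof.
have u1 : Zp1 \in Zn_units n.
  by rewrite inE; apply/existsP; exists Zp1; rewrite Zp_mul1z.
apply/group_setP; split=> [|p q].
  apply/AffP; exists Zp1, 0, u1; apply/permP=> i.
  by rewrite perm1 permE /affine_map Zp_mul1z addr0.
move=> /AffP[a [b [ha ->]]] /AffP[c [d [hc ->]]]; apply/AffP.
have hca : Zp_mul c a \in Zn_units n.
  move: ha hc; rewrite !inE => /existsP[a' /eqP a1] /existsP[c' /eqP c1].
  apply/existsP; exists (Zp_mul a' c'); apply/eqP.
  by rewrite -Zp_mulA (Zp_mulA a) a1 Zp_mul1z.
exists (Zp_mul c a), (Zp_mul c b + d), hca; apply/permP=> i.
by rewrite permM !permE /affine_map [Zp_mul c (_ + _)]Zp_mul_addr Zp_mulA addrA.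
Qed.

Canonical Aff_group (n : nat) := Group (Aff_group_set n).

Definition Aff (n : nat) : {group {perm 'I_n.+1}} := [group of Aff_set n].

(* Main.v *)
Require Import Defs.
From mathcomp Require Import all_boot all_fingroup all_algebra.

(* A permutation p of Z/n is affine iff p (x - y) = p x - p y + p 0. Taking y = 0
   in the under identity turns p ((s+1) x) into (s+1) p x - p 0; as every element
   is a multiple of s+1, the under identity becomes this criterion. The over
   identity says that p commutes with multiplication by s. Hence the two groups
   are equal as sets of permutations. *)

Import GRing.Theory.
Local Open Scope ring_scope.

Lemma Zp_mulDr (n : nat) (a x y : 'I_n.+1) :
  Zp_mul a (x + y) = Zp_mul a x + Zp_mul a y.
Proof. exact: Zp_mul_addr. Qed.

Lemma Zp_mulDl (n : nat) (a b x : 'I_n.+1) :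
  Zp_mul (a + b) x = Zp_mul a x + Zp_mul b x.
Proof. exact: Zp_mul_addl. Qed.

Lemma Zp_mulBr (n : nat) (a x y : 'I_n.+1) :
  Zp_mul a (x - y) = Zp_mul a x - Zp_mul a y.
Proof. by apply: (addIr (Zp_mul a y)); rewrite -Zp_mulDr !subrK. Qed.

Lemma Zp_mulr0 (n : nat) (a : 'I_n.+1) : Zp_mul a 0 = 0.
Proof. by rewrite -[X in Zp_mul a X](subrr 0) Zp_mulBr subrr. Qed.

Lemma inZpS (n k : nat) : inZp k.+1 = inZp k + Zp1 :> 'I_n.+1.
Proof. by apply: val_inj; rewrite /= modnDm addn1. Qed.

(** Consecutive residues [k+1] and [k] differ by [1], so the hypothesis makes [f] grow by the
    constant [f 1 - f 0] at each step; induct on the representative of [i]. *)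
Lemma affine_of_sub (n : nat) (f : 'I_n.+1 -> 'I_n.+1) :
  (forall x y, f (x - y) = f x - f y + f 0) ->
  f =1 affine_map (f Zp1 - f 0) (f 0).
Proof.
move=> fB i; rewrite -[i]valZpK; elim: (val i) => [|k IHk].
  have -> : inZp 0 = 0 :> 'I_n.+1 by apply: val_inj; rewrite /= mod0n.
  by rewrite /affine_map Zp_mulr0 add0r.
have := fB (inZp k.+1) (inZp k).
rewrite {1}inZpS addrAC subrr add0r => f1.
rewrite /affine_map inZpS Zp_mulDr -inZpS.
rewrite [Zp_mul _ Zp1]Zp_mulz1 addrAC -/(affine_map _ _ _) -IHk.
by rewrite f1 addrK addrC subrK.
Qed.

Lemma mem_Aff_sub (n : nat) (p : {perm 'I_n.+1}) :
  p \in Aff n <-> forall x y, p (x - y) = p x - p y + p 0.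
Proof.
split=> [/AffP[a [b [ha ->]]] x y | pB].
  rewrite !permE /affine_map Zp_mulBr Zp_mulr0 add0r.
  by rewrite opprD addrACA subrr addr0.
have pE := affine_of_sub _ _ pB.
rewrite inE; apply/exists_inP; exists (p Zp1 - p 0).
  (* The slope [a = p 1 - p 0] is a unit because [p] is onto: if [p c = 1 + p 0], then
     [a c + p 0 = 1 + p 0], so [a c = 1]. *)
  rewrite inE; apply/existsP; exists ((p^-1)%g (Zp1 + p 0)).
  by apply/eqP/(addIr (p 0)); rewrite -/(affine_map _ _ _) -pE permKV.
by apply/existsP; exists (p 0); apply/forallP=> i; rewrite -pE.
Qed.

Lemma preserves_overP (n : nat) (s : 'I_n.+1) (p : {perm 'I_n.+1}) :
  reflect (forall x, p (Zp_mul s x) = Zp_mul s (p x))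
          (preserves_op (dihedral_over s) p).
Proof.
apply: (iffP forallP) => [pP x | pP x]; last first.
  by apply/forallP=> y; rewrite /dihedral_over pP.
(* The over operation ignores its second argument, so [0] is an arbitrary choice. *)
by apply/eqP; have /forallP/(_ 0) := pP x.
Qed.

Lemma cent1_affineP (n : nat) (s : 'I_n.+1) (hs : s \in Zn_units n)
    (p : {perm 'I_n.+1}) :
  reflect (forall x, p (Zp_mul s x) = Zp_mul s (p x))
          (p \in 'C[affine_perm 0 hs]%g).
Proof.
have fE x : affine_perm 0 hs x = Zp_mul s x by rewrite permE /affine_map addr0.
apply: (iffP cent1P) => [pC x | pP].
  by rewrite -!fE -!permM pC.
by apply/permP=> x; rewrite !permM !fE pP.
Qed.

Lemma preserves_under_Aff (n : nat) (s : 'I_n.+1) (p : {perm 'I_n.+1}) :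
  s + Zp1 \in Zn_units n -> (forall x, p (Zp_mul s x) = Zp_mul s (p x)) ->
  preserves_op (dihedral_under s) p = (p \in Aff n).
Proof.
rewrite inE => /existsP[c /eqP sc] ps.
have s1E x : Zp_mul (s + Zp1) x = Zp_mul s x + x by rewrite Zp_mulDl Zp_mul1z.
apply/forallP/idP => [pu | /mem_Aff_sub pB x]; last first.
  apply/forallP=> y; apply/eqP; rewrite /dihedral_under pB !s1E.
  (* The difference of [s y + y] and [y] is [s y], so the criterion and commutation with [s] give
     [s (p y) = p (s y + y) - p y + p 0]. *)
  have := pB (Zp_mul s y + y) y; rewrite addrK ps => ->.
  by rewrite addrAC; congr (_ - _); rewrite [RHS]addrAC subrK.
have {}pu x y : p (Zp_mul (s + Zp1) x - y) = Zp_mul (s + Zp1) (p x) - p y.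
  by apply/eqP; have /forallP/(_ x) := pu y.
apply/mem_Aff_sub => x y.
(* Write [x = (s+1)(c x)] with [c] the inverse of [s+1]; the instance at [y = 0] then identifies
   [(s+1) p (c x)] as [p x + p 0]. *)
rewrite -[x]Zp_mul1z -sc -Zp_mulA pu.
have := pu (Zp_mul c x) 0; rewrite subr0 => ->.
by rewrite addrAC subrK.
Qed.

Theorem proposition3p5 (n : nat) (s : 'I_n.+1)
    (hs : s \in Zn_units n) (hs1 : s + Zp1 \in Zn_units n) :
  Aut_dihedral s \isog 'C_(Aff n)[affine_perm 0 hs]%g.
Proof.
suff -> : Aut_dihedral s = 'C_(Aff n)[affine_perm 0 hs]%G by exact: isog_refl.
apply/val_inj/setP=> p; rewrite [RHS]inE [LHS]inE.
have -> : preserves_op (dihedral_over s) p = (p \in 'C[affine_perm 0 hs]%g).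
  by apply/preserves_overP/cent1_affineP.
(* A [p] not commuting with [s] lies in neither group; for the others only under versus affine
   remains. *)
case: cent1_affineP => [ps | _]; last by rewrite !andbF.
by rewrite !andbT; apply: preserves_under_Aff.
Qed.
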